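(* Let $p>3$ be a prime. Then the following list is a system of representatives of the isomorphism classes of groups of order $p^3$ (every group of order $p^3$ is isomorphic to exactly one group of the list). For $1\le i\le 4$ only the nontrivial relations on the generators $g_1,g_2,g_3$ are given: $G_1$: $g_1^p=g_2,\ g_2^p=g_3$ (so $G_1\cong C_{p^3}$); $G_2$: $[g_2,g_1]=g_3$ (the group denoted $D_p$); $G_3$: $g_1^p=g_3$ (so $G_3\cong C_{p^2}\times C_p$); $G_4$: $[g_2,g_1]=g_3,\ g_1^p=g_3$ (the group denoted $Q_p$); $G_5=C_p^3$.
   Context: $C_n$ is the cyclic group of order $n$; $[h,g]=h^{-1}g^{-1}hg$. Presentation convention: each listed group is defined by the power-commutator presentation on generators $g_1,g_2,g_3$ with the displayed relations together with all omitted trivial relations: $g_i^p=1$ for every $i$ for which no relation with left-hand side $g_i^p$ is displayed, and $[g_j,g_i]=1$ for every pair $j>i$ for which no relation with left-hand side $[g_j,g_i]$ is displayed. $D_p$ and $Q_p$ are merely names for the groups given by these presentations. *)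

(* Defs.v *)
From HB Require Import structures.
From mathcomp Require Import all_boot all_fingroup all_algebra.

Set Implicit Arguments.
Unset Strict Implicit.
Unset Printing Implicit Defensive.

Local Open Scope group_scope.

(* A system of relations on three generators, interpreted in an arbitrary,     *)
(* possibly infinite, group.                                                   *)
Definition relations3 := forall T : groupType, T -> T -> T -> Prop.

(* gT is the group < g1, g2, g3 | rel >: it is generated by elements that      *)
(* satisfy rel, and every triple satisfying rel in any group H is the image of *)
(* these generators under a homomorphism gT -> H (unique, by generation).      *)
(* [\isog Grp (...)] is not used because it only tests against finite groups   *)
(* H, so it describes the largest finite factor of the presented group; here H *)
(* is not assumed finite.                                                      *)
Definition presented_by (rel : relations3) (gT : finGroupType) : Prop :=
  exists g1 g2 g3 : gT,
    [/\ <<[set g1; g2; g3]>> = [set: gT],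
        rel gT g1 g2 g3
      & forall (H : groupType) (h1 h2 h3 : H), rel H h1 h2 h3 ->
          exists f : {multiplicative gT -> H},
            [/\ f g1 = h1, f g2 = h2 & f g3 = h3]].

(* The relations g_i ^+ p = 1 and [~ g_j, g_i] = 1 that are customarily left   *)
(* out of power-commutator presentations are written out below.                *)
(* [~ x, y] is x^-1 * y^-1 * x * y.                                            *)
Definition rel_G1 (p : nat) : relations3 := fun T g1 g2 g3 =>
  [/\ g1 ^+ p = g2, g2 ^+ p = g3 & g3 ^+ p = 1] /\
  [/\ [~ g2, g1] = 1, [~ g3, g1] = 1 & [~ g3, g2] = 1].

Definition rel_G2 (p : nat) : relations3 := fun T g1 g2 g3 =>
  [/\ g1 ^+ p = 1, g2 ^+ p = 1 & g3 ^+ p = 1] /\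
  [/\ [~ g2, g1] = g3, [~ g3, g1] = 1 & [~ g3, g2] = 1].

Definition rel_G3 (p : nat) : relations3 := fun T g1 g2 g3 =>
  [/\ g1 ^+ p = g3, g2 ^+ p = 1 & g3 ^+ p = 1] /\
  [/\ [~ g2, g1] = 1, [~ g3, g1] = 1 & [~ g3, g2] = 1].

Definition rel_G4 (p : nat) : relations3 := fun T g1 g2 g3 =>
  [/\ g1 ^+ p = g3, g2 ^+ p = 1 & g3 ^+ p = 1] /\
  [/\ [~ g2, g1] = g3, [~ g3, g1] = 1 & [~ g3, g2] = 1].

(* The cyclic group C_n, for n > 1 only ('Z_0 and 'Z_1 have two elements); the *)
(* finGroupType structure of 'Z_n is the additive one.                         *)
Definition Cyc (n : nat) : finGroupType := 'Z_n.

(* The direct product, with componentwise multiplication.                      *)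
Definition dprodT (aT bT : finGroupType) : finGroupType := (aT * bT)%type.

Definition five (G1 G2 G3 G4 G5 : finGroupType) (i : 'I_5) : finGroupType :=
  nth G5 [:: G1; G2; G3; G4; G5] i.

(* Main.v *)
From HB Require Import structures.
Require Import Defs.
From mathcomp Require Import all_boot all_fingroup all_algebra all_solvable.

(** A group of order p^3 (p an odd prime) is determined up to isomorphism by
    whether it is abelian and by its exponent ([isog_p3]), so the five groups
    are told apart, and every other group is matched with one of them, by
    comparing these two invariants with the five values
      (abelian, p^3), (nonabelian, p), (abelian, p^2), (nonabelian, p^2),
      (abelian, p)
    taken, in this order, on the list.  No other value is possible because the
    exponent divides p^3, is not 1, and forces the group to be cyclic when it
    is p^3 ([exponent_p3_cases]).

    The invariants suffice for the following reasons.  An abelian group of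
    exponent p is elementary abelian; one of exponent p^2 splits over a cyclic
    subgroup of order p^2, with a complement of order p; one of exponent p^3
    is cyclic ([isog_abelian_p3]).  A nonabelian group of order p^3 is
    extraspecial, hence isomorphic to the Heisenberg group [p^{1+2}] if its
    exponent is p; otherwise an element of order p^2 generates a cyclic
    maximal subgroup, and the group is the modular group ['Mod_(p ^ 3)]
    ([isog_nonabelian_p3]).

    The groups on the list are therefore taken to be C_(p^3), [p^{1+2}],
    C_(p^2) x C_p, ['Mod_(p ^ 3)] and C_p^3.  That the first four have the
    required presentations, with a universal property that also ranges over
    infinite groups, comes from one collection argument
    ([presented_by_pc]): the relations bring every word to a normal form
    g1^a g2^b g3^c with a, b, c < p, so a group of order p^3 generated by
    g1, g2, g3 contains exactly one element for each normal form, and sending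
    normal forms to normal forms is well defined and multiplicative. *)

Set Implicit Arguments.
Unset Strict Implicit.
Unset Printing Implicit Defensive.

Local Open Scope group_scope.

(** * Collection in groups with a power-commutator presentation *)

(** The common shape of the four systems of relations: with suitable exponents
    s, t, u, e each of them implies this one, so that collection has to be
    studied only once. *)
Definition pc_rel (p s t u e : nat) (T : groupType) (g1 g2 g3 : T) : Prop :=
  [/\ g1 ^+ p = g2 ^+ s * g3 ^+ t, g2 ^+ p = g3 ^+ u & g3 ^+ p = 1] /\
  [/\ [~ g2, g1] = g3 ^+ e, [~ g3, g1] = 1 & [~ g3, g2] = 1].

Definition nform (T : groupType) (g1 g2 g3 : T) (w : nat * nat * nat) : T :=
  let: (a, b, c) := w in g1 ^+ a * g2 ^+ b * g3 ^+ c.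

(** Exponents of the product of two normal forms: moving g1^a' to the left
    across g2^b creates the central factor [~ g2, g1]^(b a') = g3^(e b a'). *)
Definition wmul (e : nat) (w w' : nat * nat * nat) : nat * nat * nat :=
  let: (a, b, c) := w in let: (a', b', c') := w' in
  (a + a', b + b', e * (b * a') + (c + c')).

(** Exponents below p of the same element: the quotient of the first exponent
    by p is carried to the second and third ones through
    g1^p = g2^s g3^t, then that of the second to the third through
    g2^p = g3^u, and the last one is dropped since g3^p = 1. *)
Definition wred (p s t u : nat) (w : nat * nat * nat) : nat * nat * nat :=
  let: (a, b, c) := w in
  let b1 := (s * (a %/ p) + b)%N in
  (a %% p, b1 %% p, (u * (b1 %/ p) + (t * (a %/ p) + c)) %% p).

Section Collection.
Variables (p s t u e : nat) (T : groupType) (g1 g2 g3 : T).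
Hypothesis gP : pc_rel p s t u e g1 g2 g3.

Lemma nformM w w' :
  nform g1 g2 g3 (wmul e w w') = nform g1 g2 g3 w * nform g1 g2 g3 w'.
Proof.
have [_ [g21 /eqP/commgP g31 /eqP/commgP g32]] := gP.
case: w w' => [[a b] c] [[a' b'] c'] /=.
have swap1 : g2 * g1 = g1 * (g2 * g3 ^+ e) by rewrite commgC g21 mulgA.
have swap2 k : g2 * g1 ^+ k = g1 ^+ k * (g2 * g3 ^+ (e * k)).
  elim: k => [|k IHk]; first by rewrite muln0 !mul1g !mulg1.
  rewrite expgSr mulgA IHk -!mulgA mulnS expgnDr.
  have -> : g3 ^+ (e * k) * g1 = g1 * g3 ^+ (e * k).
    by apply/commute_sym/commuteX/commute_sym.
  by rewrite (mulgA g2) swap1 -!mulgA.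
have swap : g2 ^+ b * g1 ^+ a' = g1 ^+ a' * (g2 ^+ b * g3 ^+ (e * (b * a'))).
  elim: b => [|b IHb]; first by rewrite !mul0n muln0 !mul1g !mulg1.
  rewrite !expgS -(mulgA g2) IHb (mulgA g2) swap2 -!mulgA; congr (_ * (_ * _)).
  rewrite (mulgA _ (g2 ^+ b)) (commuteX2 _ _ g32) -mulgA -expgnDr.
  by rewrite mulSn mulnDr.
rewrite !expgnDr -!mulgA; congr (_ * _).
rewrite (mulgA (g3 ^+ c)) (commuteX2 _ _ g31) -!mulgA [RHS]mulgA swap -!mulgA.
congr (_ * (_ * _)).
rewrite (mulgA (g3 ^+ c)) (commuteX2 _ _ g32) -!mulgA !mulgA.
by rewrite (commuteX2 _ _ g32) -!mulgA.
Qed.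

Lemma nform_wred w :
  nform g1 g2 g3 (wred p s t u w) = nform g1 g2 g3 w.
Proof.
have [[g1p g2p g3p] [_ _ /eqP/commgP g32]] := gP.
case: w => [[a b] c]; rewrite /wred; set b1 := (_ + b)%N => /=.
have red3 k : g3 ^+ (k %% p) = g3 ^+ k.
  by rewrite [in RHS](divn_eq k p) expgnDr mulnC expgnA g3p expg1n mul1g.
have red2 k : g2 ^+ k = g2 ^+ (k %% p) * g3 ^+ (u * (k %/ p)).
  rewrite [in LHS](divn_eq k p) addnC expgnDr; congr (_ * _).
  by rewrite mulnC expgnA g2p -expgnA.
have red1 : g1 ^+ a =
    g1 ^+ (a %% p) * (g2 ^+ (s * (a %/ p)) * g3 ^+ (t * (a %/ p))).
  rewrite [in LHS](divn_eq a p) addnC expgnDr; congr (_ * _).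
  rewrite mulnC expgnA g1p expgMn -?expgnA //.
  exact/commuteX2/commute_sym.
rewrite red3 red1 !expgnDr -!mulgA; congr (_ * _).
rewrite [LHS]mulgA -red2 expgnDr -!mulgA; congr (_ * _).
by rewrite !mulgA; congr (_ * _); apply/commuteX2/commute_sym.
Qed.

End Collection.

(** Any triple that satisfies the relations multiplies and reduces exponents by
    the same formulas [wmul] and [wred], whatever the ambient group.  Hence in
    a group of order p^3 generated by such a triple the p^3 reduced normal
    forms exhaust the group, so they are pairwise distinct, and an equality
    between two normal forms in this group comes from an equality between
    their reduced exponents, which makes it hold in every group where the
    relations hold. *)
Lemma presented_by_pc (rel : relations3) (p s t u e : nat) (gT : finGroupType)
    (g1 g2 g3 : gT) :
    (forall (T : groupType) (x y z : T),
      rel T x y z -> pc_rel p s t u e x y z) ->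
    0 < p -> #|[set: gT]| = (p ^ 3)%N -> <<[set g1; g2; g3]>> = [set: gT] ->
    rel gT g1 g2 g3 ->
  presented_by rel gT.
Proof.
move=> relP p_gt0 oG genG relG; exists g1, g2, g3; split=> // H h1 h2 h3 relH.
have gP := relP _ _ _ _ relG; have hP := relP _ _ _ _ relH.
pose short (w : 'I_p * 'I_p * 'I_p) : nat * nat * nat :=
  (val w.1.1, val w.1.2, val w.2).
have wredP w : {v | short v = wred p s t u w}.
  case: w => [[a b] c]; rewrite /wred.
  exists (Ordinal (ltn_pmod a p_gt0),
          Ordinal (ltn_pmod (s * (a %/ p) + b) p_gt0),
          Ordinal (ltn_pmod (u * ((s * (a %/ p) + b) %/ p)
                             + (t * (a %/ p) + c)) p_gt0)).
  by [].
pose N := nform g1 g2 g3.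
have NM v w : N (wmul e v w) = N v * N w by apply: nformM gP _ _.
have Nred w : N (wred p s t u w) = N w by apply: nform_wred gP _.
pose S := [set N (short w) | w : 'I_p * 'I_p * 'I_p].
have inS w : N w \in S.
  have [v vP] := wredP w.
  by apply/imsetP; exists v; rewrite // vP Nred.
have gS : group_set S.
  apply/group_setP; split.
    by have := inS (0, 0, 0)%N; rewrite /N /= !mulg1.
  move=> _ _ /imsetP[v _ ->] /imsetP[w _ ->].
  by rewrite -NM inS.
have S_T : S = [set: gT].
  apply/eqP; rewrite eqEsubset subsetT -genG.
  rewrite (_ : S = Group gS) // gen_subG !subUset !sub1set /=.
  have := inS (1, 0, 0)%N; have := inS (0, 1, 0)%N; have := inS (0, 0, 1)%N.
  by rewrite /N /= !mulg1 !mul1g => -> -> ->.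
(* A surjection between finite sets with p ^ 3 elements each. *)
have injN : injective (fun w => N (short w)).
  have: #|S| == #|{: 'I_p * 'I_p * 'I_p}|.
    by rewrite S_T oG !card_prod !card_ord !expnS expn0 muln1 mulnA.
  by move/imset_injP=> inj v w; apply: inj.
pose M := nform h1 h2 h3.
have MM v w : M (wmul e v w) = M v * M w by apply: nformM hP _ _.
have Mred w : M (wred p s t u w) = M w by apply: nform_wred hP _.
have transfer v w : N v = N w -> M v = M w.
  rewrite -[N v]Nred -[N w]Nred -[M v]Mred -[M w]Mred.
  by have [v' <-] := wredP v; have [w' <-] := wredP w => /injN ->.
have codeP x : exists w, N (short w) == x.
  have: x \in S by rewrite S_T inE.
  by case/imsetP=> w _ ->; exists w.
(* The image of x is read off any normal form of x, by [transfer]. *)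
pose f x := M (short (xchoose (codeP x))).
have fN w : f (N w) = M w by apply/transfer/eqP/(xchooseP (codeP (N w))).
have fM : {morph f : x y / x * y}.
  move=> x y; have /eqP <- := xchooseP (codeP x).
  have /eqP <- := xchooseP (codeP y).
  by rewrite -NM !fN MM.
pose fhom := isMultiplicative.Build gT H f fM.
pose F : {multiplicative gT -> H} := HB.pack f fhom.
exists F; split.
- by have := fN (1, 0, 0)%N; rewrite /N /M /= !mulg1.
- by have := fN (0, 1, 0)%N; rewrite /N /M /= !mulg1 !mul1g.
- by have := fN (0, 0, 1)%N; rewrite /N /M /= !mul1g.
Qed.

(** * Classification by commutativity and exponent *)

Section Classification.
Variables (p : nat) (p_prime : prime p).

Let p_gt0 : 0 < p := prime_gt0 p_prime.
Let p_gt1 : 1 < p := prime_gt1 p_prime.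

Lemma p3_pgroup (gT : finGroupType) (G : {group gT}) :
  #|G| = (p ^ 3)%N -> p.-group G.
Proof. by move=> oG; rewrite /pgroup oG pnatX pnat_id. Qed.

(** A p-group has an element whose order is the exponent, so exponent p^3 means
    cyclic, hence abelian. *)
Lemma exponent_p3_cases (gT : finGroupType) (G : {group gT}) :
  #|G| = (p ^ 3)%N ->
  [\/ exponent G = p, exponent G = (p ^ 2)%N
    | abelian G /\ exponent G = (p ^ 3)%N].
Proof.
move=> oG; have pG := p3_pgroup oG.
have := exponent_dvdn G; rewrite oG.
case/(dvdn_pfactor _ _ p_prime)=> [[|[|[|[|n]]]] //= _ e].
- suff: #|G| = 1%N by rewrite oG => /eqP; rewrite -(expn0 p) eqn_exp2l.
  by apply/eqP; rewrite -trivg_card1 trivg_exponent e.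
- by constructor 1.
- by constructor 2.
constructor 3; split=> //; have [x Gx ox] := exponent_witness (pgroup_nil pG).
suff <-: <[x]> = G by apply: cycle_abelian.
by apply/eqP; rewrite eqEcard cycle_subG Gx -orderE -ox e oG /=.
Qed.

(** In exponent p^2 both groups are C_(p^2) x C_p, because a cyclic subgroup of
    maximal order in an abelian group is a direct factor; the two other
    exponents give elementary abelian and cyclic groups, which their order
    determines. *)
Lemma isog_abelian_p3 (gT hT : finGroupType) (G : {group gT}) (H : {group hT}) :
    #|G| = (p ^ 3)%N -> #|H| = (p ^ 3)%N -> abelian G -> abelian H ->
    exponent G = exponent H ->
  G \isog H.
Proof.
move=> oG oH cGG cHH eGH.
have split2 (rT : finGroupType) (K : {group rT}) :
    #|K| = (p ^ 3)%N -> abelian K -> exponent K = (p ^ 2)%N ->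
  exists x (L : {group rT}), [/\ #[x] = (p ^ 2)%N, #|L| = p & <[x]> \x L = K].
  move=> oK cKK eK; have [x Kx ox] := exponent_witness (abelian_nil cKK).
  have /splitsP[L /complP[tixL defK]] := abelian_splits Kx (esym ox) cKK.
  exists x, L; rewrite -ox eK dprodE //; last first.
    by rewrite (sub_abelian_cent2 cKK) ?cycle_subG // -defK mulG_subr.
  split=> //; apply/eqP; rewrite -(eqn_pmul2l (order_gt0 x)) orderE.
  by rewrite -TI_cardMg // defK oK -orderE -ox eK -expnSr.
have [eG | eG | [_ eG]] := exponent_p3_cases oG.
- have abelG : p.-abelem G by rewrite abelemE // cGG eG /=.
  by rewrite (isog_abelem_card _ abelG) abelemE // cHH -eGH eG dvdnn oG oH /=.
- have [x [K [ox oK defG]]] := split2 _ _ oG cGG eG.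
  have [y [L [oy oL defH]]] := split2 _ _ oH cHH (etrans (esym eGH) eG).
  apply: (isog_dprod defG defH).
    by rewrite isog_cyclic_card ?cycle_cyclic // -!orderE ox oy /=.
  by rewrite isog_cyclic_card prime_cyclic ?oK ?oL //=.
have cyc (rT : finGroupType) (K : {group rT}) :
    #|K| = (p ^ 3)%N -> abelian K -> exponent K = (p ^ 3)%N -> cyclic K.
  move=> oK cKK eK; have [x Kx ox] := exponent_witness (abelian_nil cKK).
  apply/cyclicP; exists x; apply/esym/eqP.
  by rewrite eqEcard cycle_subG Kx -orderE -ox eK oK /=.
by rewrite isog_cyclic_card ?cyc ?oG ?oH //= -eGH.
Qed.

(** A nonabelian group of order p^3 is extraspecial; exponent p then leaves only
    the Heisenberg group.  Otherwise an element of order p^2 generates a cyclic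
    subgroup of index p, and for odd p the modular group is the only
    nonabelian p-group of its order that has one. *)
Lemma isog_nonabelian_p3 (gT : finGroupType) (G : {group gT}) :
    odd p -> #|G| = (p ^ 3)%N -> ~~ abelian G ->
  if exponent G == p then G \isog [set: p^{1+2}]
  else G \isog [set: 'Mod_(p ^ 3)].
Proof.
move=> p_odd oG ncG; have pG := p3_pgroup oG.
have esG : extraspecial G.
  by apply: (p3group_extraspecial pG); rewrite // oG pfactorK.
case: eqP => [eG | neG]; first by rewrite isog_pX1p2 // eG.
have [// | eG | [cGG _]] := exponent_p3_cases oG; last by rewrite cGG in ncG.
have [x Gx ox] := exponent_witness (pgroup_nil pG).
have sxG : <[x]> \subset G by rewrite cycle_subG.
have ixG : #|G : <[x]>| = p.
  by rewrite -divgS // oG -orderE -ox eG -expnB.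
have := maximal_cycle_extremal pG ncG (cycle_cyclic x) sxG ixG.
have /negPf-> /= : p != 2 by apply: contraTneq p_odd => ->.
rewrite orbF => /eqP/modular_group_classP[q q_prime [n n_ge isoG]].
have n_gt2 : 2 < n by apply: leq_trans n_ge; rewrite leq_addl.
have := card_isog isoG; rewrite oG card_modular_group // => e.
have qp : q = p.
  have : q %| p ^ 3 by rewrite e dvdn_exp // (leq_trans _ n_gt2).
  by rewrite Euclid_dvdX // andbT dvdn_prime2 // => /eqP.
rewrite {}qp in e isoG; suff -> : 3 = n by [].
by move/eqP: e; rewrite eqn_exp2l // => /eqP.
Qed.

Lemma isog_p3 (gT hT : finGroupType) (G : {group gT}) (H : {group hT}) :
    odd p -> #|G| = (p ^ 3)%N -> #|H| = (p ^ 3)%N ->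
  G \isog H = (abelian G == abelian H) && (exponent G == exponent H).
Proof.
move=> p_odd oG oH; apply/idP/andP=> [iso | [/eqP cGH /eqP eGH]].
  by rewrite (isog_abelian iso) (exponent_isog iso) !eqxx.
have [cGG | ncG] := boolP (abelian G).
  by apply: isog_abelian_p3; rewrite // -cGH.
have ncH : ~~ abelian H by rewrite -cGH.
have := isog_nonabelian_p3 p_odd oG ncG.
have := isog_nonabelian_p3 p_odd oH ncH.
rewrite -eGH; case: ifP => _ isoH isoG;
  by apply: isog_trans isoG _; rewrite isog_sym.
Qed.

End Classification.

(** * Cyclic groups and direct products *)

Lemma card_Cyc n : 1 < n -> #|[set: Cyc n]| = n.
Proof. by move=> n_gt1; rewrite cardsT card_ord Zp_cast. Qed.

Lemma card_dprodT (A B : finGroupType) :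
  #|[set: dprodT A B]| = (#|[set: A]| * #|[set: B]|)%N.
Proof. by rewrite !cardsT card_prod. Qed.

Lemma abelian_Cyc n : abelian [set: Cyc n].
Proof. exact: FinRing.zmod_abelian. Qed.

Lemma abelian_dprodT (A B : finGroupType) :
  abelian [set: A] -> abelian [set: B] -> abelian [set: dprodT A B].
Proof.
move=> /centsP cA /centsP cB; apply/centsP=> [[a b] _ [a' b'] _].
by congr (_, _); [apply: cA | apply: cB]; rewrite inE.
Qed.

Lemma exponent_Cyc n : 1 < n -> exponent [set: Cyc n] = n.
Proof.
move=> n_gt1; rewrite -[RHS](card_Cyc n_gt1) exponent_cyclic //.
by apply/cyclicP; exists Zp1; apply: Zp_cycle.
Qed.

Lemma exponent_dprodT (A B : finGroupType) :
  exponent [set: dprodT A B] = lcmn (exponent [set: A]) (exponent [set: B]).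
Proof.
have expgE (x : dprodT A B) n : x ^+ n = (x.1 ^+ n, x.2 ^+ n).
  by elim: n => // n IHn; rewrite !expgS IHn.
apply/eqP; rewrite eqn_dvd; apply/andP; split.
  apply/exponentP=> x _; rewrite expgE.
  by congr (_, _); apply: (exponentP _ _ (in_setT _));
    rewrite ?dvdn_lcml ?dvdn_lcmr.
rewrite dvdn_lcm; apply/andP; split; apply/exponentP=> x _.
  have := expg_exponent (in_setT ((x, 1) : dprodT A B)).
  by rewrite expgE => -[].
have := expg_exponent (in_setT ((1, x) : dprodT A B)).
by rewrite expgE => -[].
Qed.

(** * The five groups *)

Section Models.
Variables (p : nat) (p_prime : prime p).

Let p_gt0 : 0 < p := prime_gt0 p_prime.
Let p_gt1 : 1 < p := prime_gt1 p_prime.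
Let pX_gt1 n : 1 < p ^ n.+1. Proof. by rewrite (ltn_exp2l 0). Qed.

Lemma Cyc_presentation : presented_by (rel_G1 p) (Cyc (p ^ 3)%N).
Proof.
pose x : Cyc (p ^ 3)%N := Zp1.
have xp : x ^+ (p ^ 3) = 1.
  by rewrite -[X in _ ^+ X](exponent_Cyc (pX_gt1 2)) expg_exponent ?inE.
have comm1 (u v : Cyc (p ^ 3)%N) : [~ u, v] = 1.
  by apply/eqP/commgP/(centsP (abelian_Cyc _)); rewrite inE.
apply: (@presented_by_pc _ p 1 0 1 0 _ x (x ^+ p) (x ^+ p ^+ p)) => //.
- move=> T a b c; rewrite /pc_rel => -[[-> -> ->] [-> -> ->]]; rewrite !expg1.
  by split; split=> //; rewrite mulg1.
- exact: card_Cyc.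
- apply/eqP; rewrite eqEsubset subsetT /=.
  have -> : [set: Cyc (p ^ 3)%N] = <[x]> by apply: Zp_cycle.
  by rewrite cycle_subG mem_gen // !inE eqxx.
- by split; split; rewrite ?comm1 // -!expgM mulnn -expnS.
Qed.

Lemma dprodT_presentation :
  presented_by (rel_G3 p) (dprodT (Cyc (p ^ 2)%N) (Cyc p)).
Proof.
pose G3 := dprodT (Cyc (p ^ 2)%N) (Cyc p).
have expgE (u : G3) n : u ^+ n = (u.1 ^+ n, u.2 ^+ n).
  by elim: n => // n IHn; rewrite !expgS IHn.
pose x : G3 := (Zp1, 1); pose y : G3 := (1, Zp1).
have comm1 (u v : G3) : [~ u, v] = 1.
  apply/eqP/commgP/(centsP (abelian_dprodT (abelian_Cyc _) (abelian_Cyc _)));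
  by rewrite inE.
have xpp : x ^+ (p ^ 2) = 1.
  rewrite expgE expg1n.
  by rewrite -[X in _ ^+ X](exponent_Cyc (pX_gt1 1)) expg_exponent ?inE.
have yp : y ^+ p = 1.
  rewrite expgE expg1n.
  by rewrite -[X in _ ^+ X](exponent_Cyc p_gt1) expg_exponent ?inE.
apply: (@presented_by_pc _ p 0 1 0 0 _ x y (x ^+ p)) => //.
- move=> T a b c; rewrite /pc_rel => -[[-> -> ->] [-> -> ->]]; rewrite !expg1.
  by split; split=> //; rewrite mul1g.
- by rewrite card_dprodT !card_Cyc // -expnSr.
- apply/eqP; rewrite eqEsubset subsetT /=; apply/subsetP=> [[i j] _].
  have /cycleP[m ->] : i \in <[Zp1 : Cyc (p ^ 2)%N]> by rewrite -Zp_cycle inE.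
  have /cycleP[n ->] : j \in <[Zp1 : Cyc p]> by rewrite -Zp_cycle inE.
  have -> : (Zp1 ^+ m, Zp1 ^+ n) = x ^+ m * y ^+ n.
    by rewrite !expgE !expg1n; congr (_, _); rewrite ?mulg1 ?mul1g.
  by rewrite groupM // groupX // mem_gen // !inE eqxx ?orbT.
- by split; split; rewrite ?comm1 // -expgM mulnn.
Qed.

(** The standard generators x, y of the Heisenberg group are exchanged, so that
    the commutator [~ g2, g1] is [~ x, y]. *)
Lemma heisenberg_generators :
  exists g1 g2 g3 : p^{1+2},
    <<[set g1; g2; g3]>> = [set: p^{1+2}] /\ rel_G2 p g1 g2 g3.
Proof.
have := isoGrp_hom (Grp_pX1p2 p_prime) => /existsP[[x y] /=].
case/eqP=> defG xp yp /eqP/commgP czx /eqP/commgP czy.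
exists y, x, [~ x, y]; split.
  apply/eqP; rewrite eqEsubset subsetT -defG join_subG !cycle_subG.
  by rewrite !mem_gen // !inE eqxx ?orbT.
have zp : [~ x, y] ^+ p = 1 by rewrite -commXg // xp comm1g.
by split; split=> //; apply/eqP/commgP.
Qed.

(** The modular group is generated by x of order p^2 and y of order p with
    x ^ y = x^(1 + p), so that [~ x, y] = x^p.  The required relation has the
    generators in the opposite order inside the commutator; as x^p is central,
    inverting y restores the sign: [~ y^-1, x] = [~ x, y] = x^p. *)
Lemma modular_generators :
  exists g1 g2 g3 : 'Mod_(p ^ 3),
    <<[set g1; g2; g3]>> = [set: 'Mod_(p ^ 3)] /\ rel_G4 p g1 g2 g3.
Proof.
have := isoGrp_hom (@Grp_modular_group p 3 p_prime isT) => /existsP[[x y] /=].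
rewrite expn1 => /eqP[defG xpp yp xy].
have zE : [~ x, y] = x ^+ p by rewrite commgEl xy expgS mulKg.
have czy : commute (x ^+ p) y.
  apply/commgP/conjg_fixP.
  by rewrite conjXg xy -expgM mulSn expgD mulnn xpp mulg1.
exists x, y^-1, (x ^+ p); split.
  apply/eqP; rewrite eqEsubset subsetT -defG join_subG !cycle_subG.
  by rewrite -(groupV _ y) !mem_gen // !inE eqxx ?orbT.
split; split=> //.
- by rewrite expgVn yp invg1.
- by rewrite -expgM mulnn.
- have -> : [~ y^-1, x] = [~ x, y] ^ y^-1.
    by rewrite !commgEl !conjgE !invgK !mulgA mulgK.
  by rewrite zE; apply/conjg_fixP/commgP/commuteV.
- by apply/eqP/commgP/commute_sym/commuteX.
- by apply/eqP/commgP/commuteV.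
Qed.

Lemma heisenberg_presentation : presented_by (rel_G2 p) p^{1+2}%type.
Proof.
have [x [y [z [gen rel]]]] := heisenberg_generators.
apply: (@presented_by_pc _ p 0 0 0 1 _ x y z) => //; last exact: card_pX1p2.
move=> T a b c; rewrite /pc_rel => -[[-> -> ->] [-> -> ->]]; rewrite !expg1.
by split; split=> //; rewrite mulg1.
Qed.

Lemma modular_presentation : presented_by (rel_G4 p) ('Mod_(p ^ 3))%type.
Proof.
have [x [y [z [gen rel]]]] := modular_generators.
apply: (@presented_by_pc _ p 0 1 0 1 _ x y z) => //;
  last exact: card_modular_group.
move=> T a b c; rewrite /pc_rel => -[[-> -> ->] [-> -> ->]]; rewrite !expg1.
by split; split=> //; rewrite mul1g.
Qed.

Lemma heisenberg_invariants :
  odd p -> ~~ abelian p^{1+2} /\ exponent p^{1+2} = p.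
Proof.
move=> p_odd; split.
  exact: extraspecial_nonabelian (pX1p2_extraspecial p_prime).
have e := exponent_pX1p2 p_prime p_odd.
have := card_pX1p2 p_prime => /(exponent_p3_cases p_prime)[// | E | [_ E]];
  by move: e; rewrite E -[X in _ %| X]expn1 dvdn_Pexp2l.
Qed.

(** The modular group has an element of order p^2, which excludes exponent p;
    being nonabelian excludes exponent p^3. *)
Lemma modular_invariants :
  ~~ abelian 'Mod_(p ^ 3) /\ exponent 'Mod_(p ^ 3) = (p ^ 2)%N.
Proof.
set G := ('Mod_(p ^ 3))%G.
have [[x y] genG modG] :=
  generators_modular_group p_prime (isT : 2 < 3) (isog_refl G).
have [[_ ncG _] _ _ _] :=
  modular_group_structure p_prime (isT : 2 < 3) genG (isog_refl G) modG.
split=> //; case: genG => oG Gx ox _.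
have [E | // | [cGG _]] := exponent_p3_cases p_prime oG.
  have := dvdn_exponent Gx; rewrite E ox /= -[X in _ %| X]expn1.
  by rewrite dvdn_Pexp2l.
by rewrite cGG in ncG.
Qed.

End Models.

(** * The classification *)

Theorem mainTheorem4 (p : nat) (p_prime : prime p) (p_gt3 : 3 < p) :
  exists G1 G2 G3 G4 : finGroupType,
    let G5 := dprodT (dprodT (Cyc p) (Cyc p)) (Cyc p) in
    [/\ [/\ presented_by (rel_G1 p) G1, presented_by (rel_G2 p) G2,
            presented_by (rel_G3 p) G3 & presented_by (rel_G4 p) G4],
        [set: G1] \isog [set: Cyc (p ^ 3)%N],
        [set: G3] \isog [set: dprodT (Cyc (p ^ 2)%N) (Cyc p)],
        forall i : 'I_5, #|[set: five G1 G2 G3 G4 G5 i]| = (p ^ 3)%N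
      & forall (gT : finGroupType) (H : {group gT}), #|H| = (p ^ 3)%N ->
          exists! i : 'I_5, H \isog [set: five G1 G2 G3 G4 G5 i]].
Proof.
have p_gt1 := prime_gt1 p_prime.
have pX_gt1 n : 1 < p ^ n.+1 by rewrite (ltn_exp2l 0).
have p_odd : odd p.
  by apply: contraLR (p_gt3) => /(prime_oddPn p_prime) ->.
exists (Cyc (p ^ 3)%N), p^{1+2}%type, (dprodT (Cyc (p ^ 2)%N) (Cyc p)).
exists ('Mod_(p ^ 3))%type => G5; set F := five _ _ _ _ G5.
have oF i : #|[set: F i]| = (p ^ 3)%N.
  case: i => [[|[|[|[|[|//]]]]] lti] /=.
  - exact: card_Cyc.
  - exact: card_pX1p2.
  - by rewrite card_dprodT !card_Cyc // -expnSr.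
  - exact: card_modular_group.
  - by rewrite !card_dprodT !card_Cyc // -mulnA.
(* Commutativity and exponent of the five groups, in the order of the list. *)
pose table :=
  [:: (true, p ^ 3); (false, p); (true, p ^ 2); (false, p ^ 2); (true, p)]%N.
pose inv (i : 'I_5) := nth (true, p) table i.
have invF i : (abelian [set: F i], exponent [set: F i]) = inv i.
  have [nc2 e2] := heisenberg_invariants p_prime p_odd.
  have [nc4 e4] := modular_invariants p_prime.
  case: i => [[|[|[|[|[|//]]]]] lti] /=.
  - by rewrite /F /five /= abelian_Cyc exponent_Cyc.
  - by rewrite /F /five /= (negPf nc2) e2.
  - rewrite /F /five /= abelian_dprodT ?abelian_Cyc //.
    by rewrite exponent_dprodT !exponent_Cyc // (lcmn_idPl _) // dvdn_exp.
  - by rewrite /F /five /= (negPf nc4) e4.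
  rewrite /F /five /= !abelian_dprodT ?abelian_Cyc //.
  by rewrite !exponent_dprodT !exponent_Cyc // !(lcmn_idPl (dvdnn p)).
have inv_inj : injective inv.
  have uniq_table : uniq table.
    rewrite /table /= !inE !xpair_eqE /= (eqn_exp2l 3 2 p_gt1).
    by rewrite (eqn_exp2l 3 1 p_gt1) (eqn_exp2l 1 2 p_gt1)
      (eqn_exp2l 2 1 p_gt1).
  move=> i j /eqP; rewrite /inv nth_uniq // => /eqP; apply: val_inj.
split=> //; first split; try exact: isog_refl.
- exact: Cyc_presentation.
- exact: heisenberg_presentation.
- exact: dprodT_presentation.
- exact: modular_presentation.
move=> gT H oH.
have isoE i : H \isog [set: F i] = ((abelian H, exponent H) == inv i).
  by rewrite (isog_p3 p_prime p_odd oH (oF i)) -invF xpair_eqE.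
have [i Hi] : exists i, (abelian H, exponent H) = inv i.
  have [cHH | ncH] := boolP (abelian H).
    have [-> | -> | [_ ->]] := exponent_p3_cases p_prime oH.
    - by exists (@Ordinal 5 4 isT).
    - by exists (@Ordinal 5 2 isT).
    - by exists (@Ordinal 5 0 isT).
  have [-> | -> | [cHH _]] := exponent_p3_cases p_prime oH.
  - by exists (@Ordinal 5 1 isT).
  - by exists (@Ordinal 5 3 isT).
  - by rewrite cHH in ncH.
exists i; split=> [|j]; first by rewrite isoE Hi.
by rewrite isoE Hi => /eqP/inv_inj.
Qed.
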